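(* Let $A\subset\mathbb{R}^n$ be a nonempty and closed set not reduced to a singleton, and let $r>0$. Then $A$ is $r$-strongly convex if and only if $A$ is epi-Lipschitz and $r$-spherically supported.
   Context: $\|\cdot\|$ and $\langle\cdot,\cdot\rangle$ are the Euclidean norm and inner product on $\mathbb{R}^n$; $B(y;\rho)$ and $\overline{B}(y;\rho)$ are the open and closed balls of radius $\rho$ centered at $y$; $\operatorname{bdry}A$ is the topological boundary of $A$. Proximal normal cone: for $A$ nonempty and closed and $a\in A$, $N_A^P(a):=\{\zeta\in\mathbb{R}^n : \exists\,\sigma\ge 0,\ \langle\zeta,x-a\rangle\le\sigma\|x-a\|^2\ \text{for all }x\in A\}$. $r$-strongly convex: $A$ is the intersection of closed balls of the same radius $r>0$. $r$-spherically supported: for every $a\in\operatorname{bdry}A$ there exists a nonzero $\zeta_a\in N_A^P(a)$ such that $\left\langle\frac{\zeta_a}{\|\zeta_a\|},x-a\right\rangle\le-\frac{1}{2r}\|x-a\|^2$ for all $x\in A$; equivalently, $A\subset\overline{B}\left(a-r\frac{\zeta_a}{\|\zeta_a\|};r\right)$. Epi-Lipschitz: for every $a\in\operatorname{bdry}A$, the set $A$ can be viewed, in a neighborhood of $a$ and after application of an orthogonal matrix, as the epigraph of a Lipschitz continuous function. Equivalently (a known characterization): for every $a\in\operatorname{bdry}A$ there exist $v\in\mathbb{R}^n$ and $\varepsilon>0$ such that $a'+tw\in A$ for all $a'\in A\cap B(a;\varepsilon)$, all $t\in[0,\varepsilon)$ and all $w\in B(v;\varepsilon)$. *)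

(* Defs.v *)
From HB Require Import structures.
From mathcomp Require Export all_boot all_order all_algebra.
From mathcomp Require Export all_classical all_reals all_analysis.

Set Implicit Arguments.
Unset Strict Implicit.
Unset Printing Implicit Defensive.

Export Order.TTheory GRing.Theory Num.Theory.
Export numFieldNormedType.Exports.

#[global] Open Scope classical_set_scope.
#[global] Open Scope ring_scope.

(* R^n is the type 'rV[R]_n of row vectors.  The library norm `|x| on it is the
   sup norm, so the Euclidean structure is defined here; the library topology
   on 'rV[R]_n is the product topology, hence the Euclidean one. *)
Definition dotv (R : realType) (n : nat) (x y : 'rV[R]_n) : R :=
  \sum_(i < n) x ord0 i * y ord0 i.

Definition enorm (R : realType) (n : nat) (x : 'rV[R]_n) : R :=
  Num.sqrt (dotv x x).

Definition eclosed_ball (R : realType) (n : nat) (c : 'rV[R]_n) (r : R) :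
    set 'rV[R]_n :=
  closed_ball_ (@enorm R n) c r.

Definition bdry (T : topologicalType) (A : set T) : set T :=
  closure A `\` A°.

Definition proximal_normal_cone (R : realType) (n : nat)
    (A : set 'rV[R]_n) (a : 'rV[R]_n) : set 'rV[R]_n :=
  [set zeta | exists2 sigma : R, 0 <= sigma &
     forall x, A x -> dotv zeta (x - a) <= sigma * enorm (x - a) ^+ 2].

(* The family of balls, indexed by its set C of centers, may be empty: the
   whole space is r-strongly convex. *)
Definition strongly_convex (R : realType) (n : nat) (r : R)
    (A : set 'rV[R]_n) : Prop :=
  exists C : set 'rV[R]_n, A = \bigcap_(c in C) eclosed_ball c r.

Definition spherically_supported (R : realType) (n : nat) (r : R)
    (A : set 'rV[R]_n) : Prop :=
  forall a, bdry A a ->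
    exists zeta : 'rV[R]_n,
      [/\ zeta != 0, proximal_normal_cone A a zeta &
          forall x, A x ->
            dotv ((enorm zeta)^-1 *: zeta) (x - a)
              <= - ((2 * r)^-1 * enorm (x - a) ^+ 2)].

Definition Lipschitz_continuous (R : realType) (m : nat)
    (f : 'rV[R]_m -> R) : Prop :=
  exists K : R, forall x y, `|f x - f y| <= K * enorm (x - y).

Definition orthogonal_mx (R : realType) (n : nat) (Q : 'M[R]_n) : Prop :=
  Q *m Q^T = 1%:M.

(* The epigraph of f as a function of the coordinates other than the i-th. *)
Definition epigraph (R : realType) (n : nat) (i : 'I_n)
    (f : 'rV[R]_n.-1 -> R) : set 'rV[R]_n :=
  [set z | f (col' i z) <= z ord0 i].

(* The condition i.+1 = n says that i is the last coordinate; writing it this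
   way lets the definition cover every n, since for n = 0 no set has a boundary
   point. *)
Definition epi_Lipschitz (R : realType) (n : nat) (A : set 'rV[R]_n) : Prop :=
  forall a, bdry A a ->
    exists (Q : 'M[R]_n) (i : 'I_n) (f : 'rV[R]_n.-1 -> R),
      [/\ orthogonal_mx Q, i.+1 = n, Lipschitz_continuous f &
          \forall x \near a, A x <-> epigraph i f (x *m Q)].

(* Main.v *)
Require Import Defs.
From mathcomp Require Import ring lra.

(* If A is strongly convex, the set of centers of the r-balls containing A is
   compact, and at a boundary point a the center farthest from a lies at
   distance exactly r, which gives the spherical support.  The midpoint of two
   distinct points of A is interior by the parallelogram law, and a closed
   convex set with an interior point is epi-Lipschitz.

   Conversely, epi-Lipschitz is only used to get an interior point y.  If x lies
   in every r-ball containing A but not in A, let a be the last point of A on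
   the segment from y to x.  Both x and y lie in the supporting ball at a and
   differ from a, hence both make a negative inner product with the normal at a,
   although x - a and y - a point in opposite directions. *)

(** * Euclidean inner product, norm, topology and balls *)

Section EuclideanSpace.
Context {R : realType} {n : nat}.
Implicit Types (x y z a c u v : 'rV[R]_n) (t e r : R) (Q : 'M[R]_n).

Lemma dotvE x y : dotv x y = (x *m y^T) ord0 ord0.
Proof. by rewrite mxE; apply: eq_bigr => i _; rewrite mxE. Qed.

Lemma dotvC x y : dotv x y = dotv y x.
Proof. by apply: eq_bigr => i _; rewrite mulrC. Qed.

Lemma dotvDl x y z : dotv (x + y) z = dotv x z + dotv y z.
Proof. by rewrite !dotvE mulmxDl mxE. Qed.

Lemma dotvZl t x y : dotv (t *: x) y = t * dotv x y.
Proof. by rewrite !dotvE -scalemxAl mxE. Qed.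

Lemma dotvBl x y z : dotv (x - y) z = dotv x z - dotv y z.
Proof. by rewrite -scaleN1r dotvDl dotvZl mulN1r. Qed.

Lemma dotvDr x y z : dotv z (x + y) = dotv z x + dotv z y.
Proof. by rewrite dotvC dotvDl !(dotvC z). Qed.

Lemma dotvZr t x y : dotv x (t *: y) = t * dotv x y.
Proof. by rewrite dotvC dotvZl dotvC. Qed.

Lemma dotvBr x y z : dotv z (x - y) = dotv z x - dotv z y.
Proof. by rewrite dotvC dotvBl !(dotvC z). Qed.

Lemma dotv_mulmx x y Q : dotv (x *m Q) y = dotv x (y *m Q^T).
Proof. by rewrite !dotvE trmx_mul trmxK mulmxA. Qed.

Lemma dotvv_ge0 x : 0 <= dotv x x.
Proof. by apply: sumr_ge0 => i _; rewrite -expr2 sqr_ge0. Qed.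

Lemma enorm_ge0 x : 0 <= enorm x.
Proof. exact: sqrtr_ge0. Qed.

Lemma enorm_sqr x : enorm x ^+ 2 = dotv x x.
Proof. by rewrite sqr_sqrtr ?dotvv_ge0. Qed.

Lemma enormZ t x : enorm (t *: x) = `|t| * enorm x.
Proof. by rewrite /enorm dotvZl dotvZr mulrA -expr2 sqrtrM ?sqr_ge0// sqrtr_sqr. Qed.

Lemma enormN x : enorm (- x) = enorm x.
Proof. by rewrite -scaleN1r enormZ normrN1 mul1r. Qed.

Lemma enormB x y : enorm (x - y) = enorm (y - x).
Proof. by rewrite -opprB enormN. Qed.

Lemma coord_le_enorm x i : `|x ord0 i| <= enorm x.
Proof.
rewrite -ler_sqr ?nnegrE ?enorm_ge0// enorm_sqr /dotv (bigD1 i)//= real_normK ?num_real//.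
by rewrite expr2 lerDl; apply: sumr_ge0 => j _; rewrite -expr2 sqr_ge0.
Qed.

Lemma enorm_eq0 x : (enorm x == 0) = (x == 0).
Proof.
apply/eqP/eqP => [x0|->]; last by rewrite -(scale0r 0) enormZ normr0 mul0r.
apply/rowP => i; rewrite mxE; apply/eqP; rewrite -normr_le0.
by rewrite (le_trans (coord_le_enorm x i))// x0.
Qed.

Lemma enorm0 : enorm (0 : 'rV[R]_n) = 0.
Proof. by apply/eqP; rewrite enorm_eq0. Qed.

Lemma enorm_gt0 x : (0 < enorm x) = (x != 0).
Proof. by rewrite lt0r enorm_eq0 enorm_ge0 andbT. Qed.

Lemma enorm_sqrD x y :
  enorm (x + y) ^+ 2 = enorm x ^+ 2 + 2 * dotv x y + enorm y ^+ 2.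
Proof. by rewrite !enorm_sqr dotvDl !dotvDr (dotvC y x); ring. Qed.

Lemma parallelogram x y :
  enorm (x + y) ^+ 2 + enorm (x - y) ^+ 2 = 2 * (enorm x ^+ 2 + enorm y ^+ 2).
Proof. by rewrite !enorm_sqr !(dotvBl, dotvBr, dotvDl, dotvDr); ring. Qed.

(** The squared norm of |y| x - |x| y equals 2 |x| |y| (|x| |y| - <x, y>); for nonzero x and y the
    positive factor can be cancelled. *)
Lemma Cauchy_Schwarz x y : dotv x y <= enorm x * enorm y.
Proof.
have [->|x0] := eqVneq x 0; first by rewrite -{1}(scale0r 0) dotvZl mul0r mulr_ge0 ?enorm_ge0.
have [->|y0] := eqVneq y 0; first by rewrite -{1}(scale0r 0) dotvZr mul0r mulr_ge0 ?enorm_ge0.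
rewrite -enorm_gt0 in x0; rewrite -enorm_gt0 in y0.
have := dotvv_ge0 (enorm y *: x - enorm x *: y).
rewrite dotvBl !dotvBr !dotvZl !dotvZr -!enorm_sqr (dotvC y x) => h.
rewrite -(ler_pM2l (mulr_gt0 x0 y0)); nra.
Qed.

Lemma ler_enormD x y : enorm (x + y) <= enorm x + enorm y.
Proof.
rewrite -ler_sqr ?nnegrE ?addr_ge0 ?enorm_ge0// enorm_sqrD.
have := Cauchy_Schwarz x y; nra.
Qed.

Lemma ler_dist_enorm x y : `|enorm x - enorm y| <= enorm (x - y).
Proof.
have h u v : enorm u - enorm v <= enorm (u - v).
  by rewrite lerBlDr (le_trans _ (ler_enormD _ _))// subrK.
by rewrite ler_norml h lerNl opprB enormB h.
Qed.

Lemma enorm_orthogonal x Q : orthogonal_mx Q -> enorm (x *m Q) = enorm x.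
Proof. by move=> QQ; rewrite /enorm dotv_mulmx -mulmxA QQ mulmx1. Qed.

Lemma nbhs_enormP a (P : set 'rV[R]_n) :
  nbhs a P <-> exists2 e : R, 0 < e & forall x, enorm (x - a) < e -> P x.
Proof.
split=> [/nbhs_ballP[e /= e0 eP]|[e e0 eP]].
  exists e => // x xa; apply: eP; split=> // i j; rewrite /ball/= ord1.
  have := coord_le_enorm (x - a) j; rewrite !mxE distrC => h.
  exact: le_lt_trans h xa.
(* The sum of n squares of size at most (e / (n + 1))^2 stays strictly below e^2. Dividing by n + 1
   also covers n = 0. *)
apply/nbhs_ballP; exists (e / n.+1%:R) => /=; first by rewrite divr_gt0.
move=> x [_ xa]; apply: eP.
rewrite -ltr_sqr ?nnegrE ?enorm_ge0 ?(ltW e0)// enorm_sqr.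
have N0 : 0 < n.+1%:R :> R by [].
apply: (@le_lt_trans _ _ (\sum_(i < n) (e / n.+1%:R) ^+ 2)).
  apply: ler_sum => i _; have := xa ord0 i; rewrite /ball/= distrC => /ltW h.
  by rewrite -expr2 !mxE -real_normK ?num_real// ler_sqr ?nnegrE// ltW// divr_gt0.
rewrite sumr_const card_ord -[X in X < _]mulr_natr expr_div_n -mulrA gtr_pMr ?exprn_gt0//.
rewrite mulrC ltr_pdivrMr ?exprn_gt0// mul1r -natrX ltr_nat.
by rewrite -mulnn leq_pmulr.
Qed.

Lemma interior_enormP (A : set 'rV[R]_n) a :
  A° a <-> exists2 e : R, 0 < e & forall x, enorm (x - a) < e -> A x.
Proof. exact: nbhs_enormP. Qed.

Lemma closure_enormP (A : set 'rV[R]_n) a :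
  closure A a <-> forall e, 0 < e -> exists2 x, A x & enorm (x - a) < e.
Proof.
split=> [cA e e0|cA B /nbhs_enormP[e e0 eB]].
  have [|x [Ax xa]] := cA [set x | enorm (x - a) < e]; last by exists x.
  by apply/nbhs_enormP; exists e.
by have [x Ax xa] := cA e e0; exists x; split=> //; apply: eB.
Qed.

Lemma enorm_dist_continuous a : continuous (fun c => enorm (a - c)).
Proof.
move=> c; apply/(cvgrPdist_lt (FF := nbhs_filter c)) => e e0; apply/nbhs_enormP; exists e => // x xc.
apply: le_lt_trans xc; apply: le_trans (ler_dist_enorm _ _) _.
by rewrite [X in enorm X](_ : _ = x - c)//; rewrite opprB addrC addrA subrK.
Qed.

Lemma eclosed_ball_sym c r x : eclosed_ball c r x <-> eclosed_ball x r c.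
Proof. by rewrite /eclosed_ball /closed_ball_ /= enormB. Qed.

Lemma closed_eclosed_ball c r : closed (eclosed_ball c r).
Proof.
apply: (@preimage_closed _ _ (fun x => enorm (c - x)) [set t | t <= r]) => [x _|].
  exact: enorm_dist_continuous.
exact: closed_le.
Qed.

(** The ball is a closed subset of the cube with the same center and half-side r, a product of
    segments. *)
Lemma compact_eclosed_ball c r : compact (eclosed_ball c r).
Proof.
apply: (subclosed_compact (@closed_eclosed_ball c r)
  (rV_compact (fun i => @segment_compact R (c ord0 i - r) (c ord0 i + r)))).
move=> x xc i; rewrite /= in_itv/= -ler_distlC.
by have := coord_le_enorm (c - x) i; rewrite !mxE => /le_trans; apply.
Qed.

Lemma eclosed_ball_convex c r x y t : 0 <= t <= 1 ->
  eclosed_ball c r x -> eclosed_ball c r y ->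
  eclosed_ball c r ((1 - t) *: x + t *: y).
Proof.
move=> /andP[t0 t1]; rewrite /eclosed_ball /closed_ball_ /= => xc yc.
have -> : c - ((1 - t) *: x + t *: y) = (1 - t) *: (c - x) + t *: (c - y).
  by apply/rowP => i; rewrite !mxE; ring.
apply: le_trans (ler_enormD _ _) _; rewrite !enormZ !ger0_norm ?subr_ge0//; nra.
Qed.

(* Expands |x - c|^2 = |x - a|^2 + 2 <x - a, a - c> + r^2. *)
Lemma eclosed_ball_supportP c r a x : 0 <= r -> enorm (a - c) = r ->
  eclosed_ball c r x <-> 2 * dotv (a - c) (x - a) <= - enorm (x - a) ^+ 2.
Proof.
move=> r0 ac; rewrite /eclosed_ball /closed_ball_ /= (enormB c).
rewrite -ler_sqr ?nnegrE ?enorm_ge0//.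
have -> : x - c = (a - c) + (x - a) by rewrite [RHS]addrC addrA subrK.
rewrite (enorm_sqrD (a - c)) ac; split=> h; lra.
Qed.

(** With D = |p - q| and d = D^2 / (8 r), the parallelogram law bounds the squared distance from c
    to the midpoint by r^2 - D^2 / 4 = r^2 - 2 r d, which is at most (r - d)^2. The bound D <= 2 r
    ensures r - d >= 0, so that squares can be compared. *)
Lemma midpoint_eclosed_ball c r p q : 0 < r ->
  eclosed_ball c r p -> eclosed_ball c r q ->
  enorm (c - 2^-1 *: (p + q)) <= r - enorm (p - q) ^+ 2 / (8 * r).
Proof.
rewrite /eclosed_ball /closed_ball_ /= => r0 pc qc.
set D := enorm (p - q).
have D0 : 0 <= D by exact: enorm_ge0.
have D2 : D <= 2 * r.
  rewrite /D (_ : p - q = (c - q) - (c - p)); last by rewrite opprB [RHS]addrC addrA subrK.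
  by apply: le_trans (ler_enormD _ _) _; rewrite enormN; lra.
set d := D ^+ 2 / (8 * r).
have dr : d * (8 * r) = D ^+ 2 by rewrite divfK// gt_eqF// mulr_gt0.
have d2 : d <= r / 2 by nra.
have d0 : 0 <= d by rewrite divr_ge0 ?sqr_ge0// mulr_ge0// ltW.
rewrite -ler_sqr ?nnegrE ?enorm_ge0//; last by lra.
have := parallelogram (c - p) (c - q).
have -> : c - p + (c - q) = 2 *: (c - 2^-1 *: (p + q)).
  by apply/rowP => i; rewrite !mxE; field.
have -> : c - p - (c - q) = q - p by rewrite opprB addrC addrA subrK.
rewrite enormZ (enormB q p) -/D ger0_norm//.
have := enorm_ge0 (c - p); have := enorm_ge0 (c - q); nra.
Qed.

End EuclideanSpace.

(** * Splitting off one coordinate, and rotating a unit vector onto an axis *)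

Section Coordinates.
Context {R : realType} {n : nat}.
Implicit Types (x y u v : 'rV[R]_n) (i : 'I_n) (t : R).

Lemma enorm_sqr_col' x i : enorm x ^+ 2 = x ord0 i ^+ 2 + enorm (col' i x) ^+ 2.
Proof.
rewrite !enorm_sqr /dotv (bigD1_ord i)//= expr2; congr (_ + _).
by apply: eq_bigr => j _; rewrite !mxE.
Qed.

Lemma enorm_col'_le x i : enorm (col' i x) <= enorm x.
Proof.
rewrite -ler_sqr ?nnegrE ?enorm_ge0// (enorm_sqr_col' x i).
by rewrite lerDr sqr_ge0.
Qed.

Lemma col'B i x y : col' i (x - y) = col' i x - col' i y.
Proof. by apply/rowP => j; rewrite !mxE. Qed.

Lemma col'_delta i x t : col' i (x + t *: delta_mx ord0 i) = col' i x.
Proof.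
apply/rowP => j; rewrite !mxE/= eq_sym.
by rewrite (negbTE (neq_lift _ _)) mulr0 addr0.
Qed.

Lemma delta_coord i x t : (x + t *: delta_mx ord0 i) ord0 i = x ord0 i + t.
Proof. by rewrite !mxE !eqxx mulr1. Qed.

Lemma dotv_delta i x : dotv x (delta_mx ord0 i) = x ord0 i.
Proof.
rewrite /dotv (bigD1 i)//= mxE !eqxx mulr1 big1 ?addr0// => j /negbTE ji.
by rewrite mxE ji mulr0.
Qed.

Lemma enorm_delta i : enorm (delta_mx ord0 i : 'rV[R]_n) = 1.
Proof. by rewrite /enorm dotv_delta mxE !eqxx sqrtr1. Qed.

(* The Householder reflection exchanging v and the i-th basis vector; when they
   are equal, u = 0 and the convention 2 / 0 = 0 makes it the identity. *)
Lemma exists_orthogonal_mx v i : enorm v = 1 ->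
  exists2 Q : 'M[R]_n, orthogonal_mx Q & v *m Q = delta_mx ord0 i.
Proof.
move=> v1; pose e : 'rV[R]_n := delta_mx ord0 i.
have e1 : enorm e = 1 by exact: enorm_delta.
pose u := v - e; pose c := 2 / dotv u u.
have cu x : x *m (u^T *m u) = dotv x u *: u.
  by rewrite mulmxA [x *m u^T]mx11_scalar mul_scalar_mx -dotvE.
have uu0 : u != 0 -> dotv u u != 0 by move=> u0; rewrite -enorm_sqr expf_neq0// enorm_eq0.
(* This makes the symmetric matrix 1 - c u^T u an involution, hence orthogonal. If u = 0, both sides
   vanish. *)
have ccu : c * (c * dotv u u) = 2 * c.
  have [u0|/uu0 u0] := eqVneq u 0; last by rewrite /c; field.
  by rewrite /c u0 -enorm_sqr enorm0 expr0n invr0 !mulr0.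
exists (1%:M - c *: (u^T *m u)).
  have Qt : (1%:M - c *: (u^T *m u))^T = 1%:M - c *: (u^T *m u).
    by rewrite linearB linearZ/= trmx1 trmx_mul trmxK.
  have MM : u^T *m u *m (u^T *m u) = dotv u u *: (u^T *m u).
    by rewrite -mulmxA cu scalemxAr.
  move: (u^T *m u) Qt MM => M Qt MM.
  rewrite /orthogonal_mx Qt mulmxBl mul1mx mulmxBr mulmx1.
  rewrite -scalemxAl -scalemxAr MM !scalerA -mulrA ccu.
  by apply/matrixP => j k; rewrite !mxE; ring.
rewrite mulmxBr mulmx1 -scalemxAr cu scalerA.
have [u0|u0] := eqVneq u 0.
  by rewrite u0 scaler0 subr0; apply/eqP; rewrite -subr_eq0 -/u u0.
(* Since v and e are both unit vectors, <u, u> = 2 <v, u>; the reflection thus sends v to v - u =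
   e. *)
have -> : c * dotv v u = 1.
  have uuE : dotv u u = 2 * dotv v u.
    by rewrite /u !(dotvBl, dotvBr) -!enorm_sqr v1 e1 (dotvC e v); ring.
  by rewrite /c mulrAC -uuE divff ?uu0.
by rewrite scale1r /u opprB addrC subrK.
Qed.

End Coordinates.

(** * Strong convexity, spherical supports and local epigraphs *)

Section StrongConvexity.
Context {R : realType} {n : nat}.
Implicit Types (A C : set 'rV[R]_n) (x y z a m b w c u v : 'rV[R]_n) (t e r s d : R).

(* The boundary point is the last point of A on the segment from y to x. *)
Lemma segment_exit A y x : closed A -> A y -> ~ A x ->
  exists2 t, 0 <= t < 1 & bdry A (y + t *: (x - y)).
Proof.
move=> clA Ay nAx.
pose S : set R := [set t | 0 <= t <= 1 /\ A (y + t *: (x - y))].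
have S0 : S 0 by rewrite /S/= scale0r addr0 lexx ler01.
have ubS : ubound S 1 by move=> t [/andP[]].
have hsS : has_sup S by split; [exists 0|exists 1].
have leS t : S t -> t <= sup S by move=> St; apply: ub_le_sup => //; exists 1.
set s := sup S in leS.
have s01 : 0 <= s <= 1 by rewrite leS//= ge_sup//; exists 0.
set L := enorm (x - y).
have dS t t' : enorm (y + t *: (x - y) - (y + t' *: (x - y))) = `|t - t'| * L.
  by rewrite opprD addrACA subrr add0r -scalerBl enormZ.
have L0 : 0 <= L by exact: enorm_ge0.
(* Dividing by L + 1 avoids treating L = 0 apart. *)
have Ls e : 0 < e -> exists2 d, 0 < d & d * L < e.
  by move=> e0; exists (e / (L + 1)); [rewrite divr_gt0//|rewrite mulrAC ltr_pdivrMr]; nra.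
have As : A (y + s *: (x - y)).
  apply: clA; apply/closure_enormP => e /Ls[d d0 dL].
  have [t St ts] := sup_adherent d0 hsS; exists (y + t *: (x - y)); first by case: St.
  rewrite dS; apply: le_lt_trans dL; rewrite ler_wpM2r// distrC ger0_norm; last by rewrite subr_ge0 leS.
  by rewrite -/s in ts; lra.
have s1 : s < 1.
  rewrite lt_neqAle (andP s01).2 andbT; apply/eqP => sE.
  by apply: nAx; move: As; rewrite sE scale1r addrC subrK.
exists s; first by rewrite s1 (andP s01).1.
split; first exact: subset_closure.
move=> /interior_enormP[e /Ls[d d0 dL] eA].
pose t := Num.min 1 (s + d).
have st : s < t by rewrite lt_min s1 ltrDl.
suff /leS : S t by rewrite leNgt st.
split; first by rewrite ge_min lexx/= andbT (le_trans (andP s01).1)// ltW.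
apply: eA; rewrite dS; apply: le_lt_trans dL; rewrite ler_wpM2r// ger0_norm ?subr_ge0 ?(ltW st)//.
by rewrite lerBlDl ge_min lexx orbT.
Qed.

(** Moving up from a by e / 2 in the epigraph direction gives a point with room below it; the
    Lipschitz bound keeps the graph from filling that room nearby. *)
Lemma epi_Lipschitz_interior A a : epi_Lipschitz A -> bdry A a -> A a ->
  A° !=set0.
Proof.
move=> eA ba Aa; have [Q [i [f [QQ iE [K Klip] /nbhs_enormP[e e0 eP]]]]] := eA a ba.
have QQ' : Q^T *m Q = 1%:M by apply: mulmx1C.
pose w := delta_mx ord0 i *m Q^T : 'rV_n.
have wQ : w *m Q = delta_mx ord0 i by rewrite -mulmxA QQ' mulmx1.
have w1 : enorm w = 1 by rewrite -(enorm_orthogonal w _ QQ) wQ enorm_delta.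
pose m := a + (e / 2) *: w.
have mQ : m *m Q = a *m Q + (e / 2) *: delta_mx ord0 i.
  by rewrite mulmxDl -scalemxAl wQ.
exists m; apply/interior_enormP.
(* The Lipschitz constant of the definition may be negative. *)
have [K' K'0 KK'] : exists2 K' : R, 0 <= K' & K <= K'.
  by exists (Num.max K 0); rewrite le_max lexx ?orbT.
(* Within d of m, the graph rises by at most K' d and the height drops by less than d: together at
   most e / 4, less than the e / 2 gained. Such points also stay within e of a. *)
pose d : R := e / (4 * (K' + 1)).
have dE : d * (K' + 1) = e / 4 by rewrite /d; field; rewrite gt_eqF//; lra.
have d0 : 0 < d by rewrite divr_gt0//; lra.
exists d => // x xm; have mae : enorm (m - a) = e / 2.
  by rewrite /m addrAC subrr add0r enormZ w1 mulr1 gtr0_norm// divr_gt0.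
apply/eP.
  have -> : x - a = (x - m) + (m - a) by rewrite addrA subrK.
  by apply: le_lt_trans (ler_enormD _ _) _; rewrite mae; nra.
have fa : f (col' i (a *m Q)) <= (a *m Q) ord0 i.
  by apply/eP => //; rewrite subrr enorm0.
have xmQ : enorm (x *m Q - m *m Q) < d by rewrite -mulmxBl enorm_orthogonal.
have := coord_le_enorm (x *m Q - m *m Q) i.
rewrite [X in `|X|]mxE [X in _ + X]mxE mQ delta_coord ler_norml => /andP[xi _].
have := enorm_col'_le (x *m Q - m *m Q) i; rewrite col'B => xc.
have := Klip (col' i (x *m Q)) (col' i (m *m Q)).
rewrite ler_norml => /andP[_]; rewrite {1}mQ col'_delta => fx.
have fd : f (col' i (x *m Q)) - f (col' i (a *m Q)) <= K' * d.
  apply: le_trans fx _; apply: (@le_trans _ _ (K' * enorm (col' i (x *m Q) - col' i (m *m Q)))).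
    by rewrite ler_wpM2r ?enorm_ge0.
  by rewrite ler_wpM2l// (le_trans xc)// ltW.
rewrite /epigraph/=; rewrite mQ in xmQ; nra.
Qed.

Lemma strongly_convex_support A r a : strongly_convex r A -> closed A ->
  bdry A a -> exists2 c, enorm (a - c) = r & A `<=` eclosed_ball c r.
Proof.
move=> [C AC] clA [cAa nia]; have Aa : A a by exact: clA.
(* By symmetry of the distance, these are the centers of the r-balls containing A. In this form the
   set is visibly closed, and bounded because it lies in the ball about a. *)
pose C' := \bigcap_(x in A) eclosed_ball x r.
have CC' : C `<=` C'.
  by move=> c Cc x; rewrite AC => /(_ c Cc) /eclosed_ball_sym.
have C'0 : C' !=set0.
  (* An empty family of balls would make A the whole space, which has no boundary. *)
  have [C0|/set0P[c Cc]] := eqVneq C set0; last by exists c; apply: CC'.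
  by case: nia; rewrite AC C0 bigcap_set0 interiorT.
have cC' : compact C'.
  apply: (subclosed_compact _ (compact_eclosed_ball a r)).
    by apply: closed_bigI => x _; apply: closed_eclosed_ball.
  by move=> c; apply.
have [c /set_mem C'c cmax] := compact_EVT_max C'0 cC'
  (continuous_subspaceT (enorm_dist_continuous a)).
exists c; last by move=> x Ax; apply/eclosed_ball_sym; apply: C'c.
(* If |a - c| < r, then by maximality every b in [C] has |a - b| <= |a - c|, so the open ball about
   a of radius r - |a - c| lies in every ball of the family and a is interior. *)
apply/eqP; rewrite eq_le (C'c a Aa) leNgt; apply/negP => acr; apply: nia.
apply/interior_enormP; exists (r - enorm (a - c)); first by rewrite subr_gt0.
move=> x xa; rewrite AC => b Cb; have := cmax b (mem_set (CC' b Cb)).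
rewrite /eclosed_ball /closed_ball_/= (enormB b).
rewrite (_ : x - b = (x - a) + (a - b)); last by rewrite addrA subrK.
by have := ler_enormD (x - a) (a - b); lra.
Qed.

Lemma strongly_convex_spherically_supported A r : 0 < r -> closed A ->
  strongly_convex r A -> spherically_supported r A.
Proof.
move=> r0 clA scA a /(strongly_convex_support _ _ _ scA clA)[c ac Ac].
have supp x : A x -> 2 * dotv (a - c) (x - a) <= - enorm (x - a) ^+ 2.
  by move=> /Ac /(eclosed_ball_supportP _ _ _ _ (ltW r0) ac).
exists (a - c); split.
- by rewrite -enorm_gt0 ac.
- exists 0 => // x /supp; rewrite mul0r.
  by have := sqr_ge0 (enorm (x - a)); lra.
- move=> x /supp h; rewrite ac dotvZl invfM -mulrA mulrCA -mulrN.
  by rewrite ler_pM2l ?invr_gt0//; lra.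
Qed.

Lemma spherically_supported_strongly_convex A r : 0 < r -> closed A ->
  A !=set0 -> (forall a, bdry A a -> A° !=set0) ->
  spherically_supported r A -> strongly_convex r A.
Proof.
move=> r0 clA [p Ap] iA ssA; exists [set c | A `<=` eclosed_ball c r].
apply/seteqP; split=> [x Ax c|x Cx]; first exact.
(* A first exit, from an arbitrary point of A, only provides a boundary point and hence an interior
   point y. The second exit starts at y, so its boundary point a differs from y. *)
apply: contrapT => nAx; have [? _ /iA[y iAy]] := segment_exit _ _ _ clA Ap nAx.
have Ay := interior_subset iAy.
have [t /andP[t0 t1]] := segment_exit _ _ _ clA Ay nAx.
set a := y + t *: (x - y) => ba.
have [zeta [z0 _ zA]] := ssA a ba.
have Aa : A a by apply: clA; case: ba.
pose u := (enorm zeta)^-1 *: zeta.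
have u1 : enorm u = 1.
  by rewrite enormZ gtr0_norm ?invr_gt0 ?enorm_gt0// mulVf ?enorm_eq0.
pose c := a - r *: u.
have ac : enorm (a - c) = r.
  by rewrite /c opprB addrC subrK enormZ u1 mulr1 gtr0_norm.
(* The ball touches its tangent hyperplane at a only. *)
have sep z : z != a -> eclosed_ball c r z -> dotv u (z - a) < 0.
  move=> za /(eclosed_ball_supportP _ _ _ _ (ltW r0) ac).
  rewrite {1}/c opprB addrC subrK dotvZl => h.
  have : 0 < enorm (z - a) ^+ 2 by rewrite exprn_gt0// enorm_gt0 subr_eq0.
  nra.
have Ac : A `<=` eclosed_ball c r.
  move=> z /zA; rewrite -/u => h.
  apply/(eclosed_ball_supportP _ _ _ _ (ltW r0) ac).
  rewrite {1}/c opprB [X in dotv X]addrC subrK dotvZl.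
  have e2 : (2 * r)^-1 * enorm (z - a) ^+ 2 * (2 * r) = enorm (z - a) ^+ 2.
    by field; rewrite gt_eqF.
  nra.
have xa : x != a by apply/eqP => xa; apply: nAx; rewrite xa.
have ya : y != a by apply/eqP => ya; case: ba => _; rewrite -ya.
have := sep x xa (Cx c Ac); have := sep y ya (Ac y Ay).
have -> : y - a = - t *: (x - y) by rewrite /a opprD addrA subrr add0r scaleNr.
have -> : x - a = (1 - t) *: (x - y).
  by rewrite /a opprD addrA scalerBl scale1r.
rewrite !dotvZr; nra.
Qed.

(** The margin in [midpoint_eclosed_ball] does not depend on the center, so one ball about the
    midpoint of two distinct points fits in all balls of the family. *)
Lemma strongly_convex_ball A r : 0 < r -> A !=set0 ->
  (forall a, A <> [set a]) -> strongly_convex r A ->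
  exists m, exists2 d, 0 < d & eclosed_ball m d `<=` A.
Proof.
move=> r0 [p Ap] nA [C AC].
have [q Aq qp] : exists2 q, A q & q != p.
  apply: contrapT => h; apply: (nA p); apply/seteqP; split=> [q Aq|_ ->//].
  by apply: contrapT => /eqP qp; apply: h; exists q.
exists (2^-1 *: (p + q)), (enorm (p - q) ^+ 2 / (8 * r)).
  apply: divr_gt0; last exact: mulr_gt0.
  by rewrite exprn_gt0// enorm_gt0 subr_eq0 eq_sym.
move=> x; rewrite AC {1}/eclosed_ball /closed_ball_/= => xm c Cc.
rewrite AC in Ap Aq; have := midpoint_eclosed_ball _ _ _ _ r0 (Ap c Cc) (Aq c Cc).
rewrite /eclosed_ball /closed_ball_/=.
set m := 2^-1 *: _ in xm *.
have -> : c - x = (c - m) + (m - x) by rewrite addrA subrK.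
by have := ler_enormD (c - m) (m - x); lra.
Qed.

Lemma strongly_convex_convex A r x y t : strongly_convex r A -> 0 <= t <= 1 ->
  A x -> A y -> A ((1 - t) *: x + t *: y).
Proof.
move=> [C ->] t01 Ax Ay c Cc.
by apply: eclosed_ball_convex => //; [apply: Ax|apply: Ay].
Qed.

(** The point b + w lies within d of m, hence in A, and convexity gives the segment from b to it. So
    the points of A near a carry a common truncated cone of directions around m - a. *)
Lemma convex_ball_cone A a m d b w t :
  (forall x y s, 0 <= s <= 1 -> A x -> A y -> A ((1 - s) *: x + s *: y)) ->
  eclosed_ball m d `<=` A -> A b -> enorm (b - a) <= d / 2 ->
  enorm (w - (m - a)) <= d / 2 -> 0 <= t <= 1 -> A (b + t *: w).
Proof.
move=> cA mA Ab ba wm t01.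
have -> : b + t *: w = (1 - t) *: b + t *: (b + w).
  by rewrite scalerBl scale1r scalerDr addrA subrK.
apply: cA => //; apply: mA; rewrite /eclosed_ball /closed_ball_/= enormB.
have -> : b + w - m = (b - a) + (w - (m - a)).
  by apply/rowP => i; rewrite !mxE; ring.
by apply: le_trans (ler_enormD _ _) _; lra.
Qed.

(* Near a boundary point a, the set is the epigraph, in the direction from a
   to m, of the infimum of the upward cones with apex at points of A close
   to a: such a cone lies in A as long as it is not followed too far. *)
Lemma convex_epi_Lipschitz A m d (i : 'I_n) : i.+1 = n -> closed A ->
  (forall x y s, 0 <= s <= 1 -> A x -> A y -> A ((1 - s) *: x + s *: y)) ->
  0 < d -> eclosed_ball m d `<=` A -> epi_Lipschitz A.
Proof.
move=> iE clA cA d0 mA a ba; have Aa : A a by apply: clA; case: ba.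
pose h := enorm (m - a).
have h0 : 0 < h.
  rewrite enorm_gt0 subr_eq0; apply/eqP => ma; case: ba => _; apply.
  apply/interior_enormP; exists d => // x; rewrite -ma enormB => /ltW xm.
  exact: mA.
pose v := h^-1 *: (m - a).
have hv : m - a = h *: v by rewrite scalerA mulfV ?gt_eqF// scale1r.
have v1 : enorm v = 1 by rewrite enormZ gtr0_norm ?invr_gt0// mulVf ?gt_eqF.
clearbody v.
have [Q QQ vQ] := exists_orthogonal_mx _ i v1.
(* A vector above the cone of slope L, rescaled to height h, deviates from h v = m - a by at most h
   / L = d / 2, the tolerance of [convex_ball_cone]. *)
pose L := 2 * h / d.
have L0 : 0 < L by rewrite divr_gt0// mulr_gt0.
have Ld : L * d = 2 * h by rewrite /L divfK// gt_eqF.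
(* The bound d / 2 is the tolerance on the apex b. The bound h / 3 on each of |x - a|, |b - a| and
   the lift [eta] keeps the height s below at most h, so that s / h <= 1. *)
pose rho := Num.min (d / 2) (h / 3).
have rho0 : 0 < rho by rewrite lt_min !divr_gt0.
have rhod : rho <= d / 2 by rewrite ge_min lexx.
have rhoh : rho <= h / 3 by rewrite ge_min lexx orbT.
pose N := [set b | A b /\ enorm (b - a) <= rho].
pose g b (y : 'rV[R]_n.-1) := (b *m Q) ord0 i + L * enorm (y - col' i (b *m Q)).
pose S (y : 'rV[R]_n.-1) := [set g b y | b in N].
have hiS (y : 'rV[R]_n.-1) : has_inf (S y).
  split; first by exists (g a y), a => //; split=> //; rewrite subrr enorm0 ltW.
  exists ((a *m Q) ord0 i - rho) => _ [b [Ab ba'] <-].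
  have := coord_le_enorm ((b - a) *m Q) i; rewrite enorm_orthogonal//.
  rewrite mulmxBl [X in `|X|]mxE [X in _ + X]mxE ler_norml => /andP[bi _].
  have := mulr_ge0 (ltW L0) (enorm_ge0 (y - col' i (b *m Q))); rewrite /g; lra.
pose f (y : 'rV[R]_n.-1) := inf (S y).
have fg (y : 'rV[R]_n.-1) b : N b -> f y <= g b y.
  by move=> Nb; apply: ge_inf; [exact: (hiS y).2|exists b].
(* An infimum of functions with Lipschitz constant L inherits that constant. *)
have flip (x y : 'rV[R]_n.-1) : f x - f y <= L * enorm (x - y).
  rewrite lerBlDr addrC -lerBlDr; apply: lb_le_inf; first exact: (hiS y).1.
  move=> _ [b Nb <-]; rewrite lerBlDr (le_trans (fg x b Nb))// /g -addrA lerD2l.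
  rewrite -mulrDr ler_pM2l//.
  have -> : x - col' i (b *m Q) = (y - col' i (b *m Q)) + (x - y).
    by rewrite [RHS]addrC addrA subrK.
  exact: ler_enormD.
exists Q, i, f; split=> //.
  exists L => x y; rewrite ler_norml flip andbT lerNl opprB.
  by rewrite (enormB x).
apply/nbhs_enormP; exists rho => // x xa; rewrite /epigraph/=; split=> [Ax|fx].
  by apply: le_trans (fg _ x _) _; [split=> //; exact: ltW|rewrite /g subrr enorm0 mulr0 addr0].
(* The infimum need not be known to be attained: x is lifted by a small [eta], which puts it
   strictly above the cone of some apex b, and closedness of A brings it back. *)
apply: clA; apply/closure_enormP => e e0.
pose eta := Num.min (e / 2) (h / 3).
have eta0 : 0 < eta by rewrite lt_min !divr_gt0.
have etah : eta <= h / 3 by rewrite ge_min lexx orbT.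
have etae : eta <= e / 2 by rewrite ge_min lexx.
exists (x + eta *: v); last first.
  by rewrite addrAC subrr add0r enormZ v1 gtr0_norm// mulr1; lra.
have [_ [b [Ab ba'] <-] gb] := inf_adherent eta0 (hiS (col' i (x *m Q))).
pose z := x + eta *: v - b.
have zQ : z *m Q = x *m Q - b *m Q + eta *: delta_mx ord0 i.
  by rewrite /z addrAC mulmxDl mulmxBl -scalemxAl vQ.
pose s := (z *m Q) ord0 i.
have sE : s = (x *m Q) ord0 i - (b *m Q) ord0 i + eta.
  by rewrite /s zQ delta_coord; congr (_ + _); rewrite mxE [X in _ + X]mxE.
have zs : L * enorm (col' i (z *m Q)) < s.
  rewrite zQ col'_delta col'B sE; move: gb; rewrite /g -/(f _); lra.
have s0 : 0 < s by apply: le_lt_trans zs; rewrite mulr_ge0 ?enorm_ge0// ltW.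
have sh : s <= h.
  apply: le_trans (ler_norm _) _; apply: le_trans (coord_le_enorm _ _) _.
  rewrite enorm_orthogonal//.
  have -> : z = (x - a) + (eta *: v + (a - b)).
    by apply/rowP => j; rewrite !mxE; ring.
  apply: le_trans (ler_enormD _ _) _.
  have := ler_enormD (eta *: v) (a - b).
  rewrite enormZ v1 mulr1 gtr0_norm// (enormB a b); lra.
(* After rotation, subtracting s v cancels exactly the i-th coordinate of z. *)
have zv : enorm (z - s *: v) = enorm (col' i (z *m Q)).
  rewrite -(enorm_orthogonal (z - s *: v) _ QQ) mulmxBl -scalemxAl vQ -scaleNr.
  apply/eqP; rewrite -(@eqrXn2 _ 2) ?enorm_ge0//.
  by rewrite (enorm_sqr_col' _ i) delta_coord col'_delta subrr expr0n add0r.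
have -> : x + eta *: v = b + (s / h) *: ((h / s) *: z).
  rewrite scalerA mulrA divfK ?gt_eqF// divff ?gt_eqF// scale1r.
  by rewrite /z [RHS]addrC subrK.
apply: (convex_ball_cone A a m d) => //.
- exact: le_trans rhod.
- have -> : (h / s) *: z - (m - a) = (h / s) *: (z - s *: v).
    by rewrite hv [RHS]scalerBr scalerA divfK ?gt_eqF.
  rewrite enormZ zv.
  rewrite gtr0_norm ?divr_gt0// mulrAC ler_pdivrMr//; nra.
- by rewrite divr_ge0 ?(ltW s0) ?(ltW h0)//= ler_pdivrMr// mul1r.
Qed.

End StrongConvexity.

Theorem corollary1p2 (R : realType) (n : nat) (A : set 'rV[R]_n) (r : R)
    (A_nonempty : A !=set0) (A_closed : closed A)
    (A_not_singleton : forall a : 'rV[R]_n, A <> [set a]) (r_gt0 : 0 < r) :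
  strongly_convex r A <-> epi_Lipschitz A /\ spherically_supported r A.
Proof.
split=> [scA|[eA ssA]]; last first.
  apply: spherically_supported_strongly_convex => // a ba.
  by apply: (epi_Lipschitz_interior A a) => //; apply: A_closed; case: ba.
split; last exact: strongly_convex_spherically_supported.
case: n A A_nonempty A_closed A_not_singleton scA => [|n] A A0 clA nA scA.
  (* In dimension 0 the space is a single point, so a nonempty A would be a singleton; otherwise a
     last coordinate exists. *)
  case: A0 => p Ap; case: (nA p); apply/seteqP; split=> [q _|_ ->//].
  by apply/rowP => -[].
have [m [d d0 mA]] := strongly_convex_ball A r r_gt0 A0 nA scA.
apply: (convex_epi_Lipschitz A m d ord_max) => // x y s.
exact: (strongly_convex_convex _ _ _ _ _ scA).
Qed.
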